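(* On $(M_1\times M_2,G_{f_1f_2})$, let $\{e_1,\dots,e_{m_1}\}$ be a local orthonormal frame field of $M_1$ with respect to $g_1$ and $\{e_{m_1+1},\dots,e_{m_1+m_2}\}$ a local orthonormal frame field of $M_2$ with respect to $g_2$. Put $$u'_j=\frac{1}{f_2^v}e_j^h,\qquad j\in\{1,\dots,m_1\},$$ $$u'_j=\frac{c\,a_j^v}{1-c^2b_1^hA_j^v}\Big\{-\frac1{f_2^v}(\mathrm{grad} f_1)^h+\frac{c\,b_1^h}{f_1^h}T_j^v\Big\}+\frac{1}{f_1^h}e_j^v,\qquad j\in\{m_1+1,\dots,m_1+m_2\},$$ where, for $j\in\{m_1+1,\dots,m_1+m_2\}$, $a_j=e_j(f_2)$, $A_j=\sum_{i=m_1+1}^{j-1}a_i^2$ (also for $j=m_1+m_2+1$), $T_j=\sum_{i=m_1+1}^{j-1}a_ie_i$. Let $u_j=u'_j$ for $j\le m_1$ and $u_j=\frac{1}{\|u'_j\|}u'_j$ for $j\in\{m_1+1,\dots,m_1+m_2\}$. Then, for $j\in\{m_1+1,\dots,m_1+m_2\}$, $$\|u'_j\|^2=\frac{1-c^2b_1^hA_{j+1}^v}{1-c^2b_1^hA_j^v},$$ and $\{u_1,\dots,u_{m_1},u_{m_1+1},\dots,u_{m_1+m_2}\}$ is a local orthonormal frame field with respect to the metric $G_{f_1f_2}$.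
   Context: $(M_i,g_i)$, $i=1,2$, are Riemannian manifolds of dimension $m_i$; $\pi_i:M_1\times M_2\to M_i$ are the projections; $\varphi_1^h=\varphi_1\circ\pi_1$, $\varphi_2^v=\varphi_2\circ\pi_2$ for functions. The horizontal lift $X_1^h$ of a vector field $X_1$ on $M_1$ is the vector field on $M_1\times M_2$ with $d\pi_1(X_1^h)=X_1\circ\pi_1$, $d\pi_2(X_1^h)=0$; the vertical lift $X_2^v$ of a vector field on $M_2$ is defined symmetrically. $f_i:M_i\to(0,\infty)$ is smooth, $c\in\mathbb R$, and $$G_{f_1f_2}=(f_2^v)^2\pi_1^*g_1+(f_1^h)^2\pi_2^*g_2+c f_1^hf_2^v\,df_1^h\odot df_2^v,\qquad \alpha\odot\beta=\alpha\otimes\beta+\beta\otimes\alpha.$$ $\mathrm{grad} f_i$ is the $g_i$-gradient and $b_i=g_i(\mathrm{grad} f_i,\mathrm{grad} f_i)$. Standing assumption: $0\le c^2b_1^hb_2^v<1$ everywhere, so that $G_{f_1f_2}$ is a Riemannian metric. $\|u'_j\|$ is the norm with respect to $G_{f_1f_2}$. Empty sums are zero. *)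

(* Defs.v *)
From HB Require Import structures.
From mathcomp Require Import all_boot all_order all_algebra.
From mathcomp Require Import all_classical all_reals all_analysis.

Set Implicit Arguments.
Unset Strict Implicit.
Unset Printing Implicit Defensive.

Import Order.TTheory GRing.Theory Num.Theory.
Import numFieldNormedType.Exports.

Local Open Scope classical_set_scope.
Local Open Scope ring_scope.

(* Smoothness on an open subset U of a finite-dimensional space.  Only the    *)
(* values of f on U matter, since U is meant to be open.                      *)

Fixpoint Ck_on (R : realType) (V W : normedModType R) (k : nat) (U : set V)
    (f : V -> W) : Prop :=
  if k is k'.+1 then
    (forall x, U x -> differentiable f x) /\
    (forall v, Ck_on k' U (fun x => 'D_v f x))
  else forall x, U x -> {for x, continuous f}.

Definition smooth_on (R : realType) (V W : normedModType R) (U : set V)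
    (f : V -> W) : Prop :=
  forall k, Ck_on k U f.

Section SmoothFacts.
Context {R : realType}.

Lemma near_eq_diff (V W : normedModType R) (f g : V -> W) x :
  {near x, f =1 g} -> differentiable f x ->
  differentiable g x /\ 'd g x = 'd f x :> (V -> W).
Proof.
move=> fg df.
have fgx : f x = g x by exact: (nbhs_singleton fg).
have gloc : g \o shift x = cst (g x) + 'd f x +o_ 0 id.
  apply/eqaddoP => e e0.
  have /eqaddoP/(_ e e0) fo := diff_locally df.
  have fg0 : \forall h \near 0, f (h + x) = g (h + x).
    by move: fg; rewrite (near_shift 0) /= => fg; move: fg; apply: filterS => h; rewrite subr0.
  near=> h; have -> : (g \o shift x - (cst (g x) + 'd f x)) h =
     (f \o shift x - (cst (f x) + 'd f x)) h.
    by rewrite !fctE /= fgx; congr (_ - _); apply/esym; near: h.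
  by near: h.
have dgE : 'd g x = 'd f x :> (V -> W).
  by apply: diff_unique => //; exact: diff_continuous.
split=> //; apply/diff_locallyP; rewrite dgE; split=> //.
exact: diff_continuous.
Unshelve. all: by end_near. Qed.

Lemma near_open (V : topologicalType) (U : set V) x (P : V -> Prop) :
  open U -> U x -> (forall y, U y -> P y) -> \forall y \near x, P y.
Proof. by move=> oU Ux UP; exact: filterS (open_nbhs_nbhs (conj oU Ux)). Qed.

Lemma eq_Ck_on (V W : normedModType R) k (U : set V) (f g : V -> W) :
  open U -> (forall x, U x -> f x = g x) -> Ck_on k U f -> Ck_on k U g.
Proof.
move=> oU; elim: k f g => [|k IH] f g fg /=.
  move=> cf x Ux.
  have nfg : {near x, f =1 g} by exact: near_open oU Ux fg.
  change (g @ x --> g x); rewrite -(fg _ Ux); apply: cvg_trans (cf x Ux).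
  exact: near_eq_cvg.
move=> [df Df]; split=> [x Ux|v].
  by have [] := near_eq_diff (near_open oU Ux fg) (df x Ux).
apply: (IH _ _ _ (Df v)) => x Ux.
exact/near_eq_derive/(near_open oU Ux fg).
Qed.

Lemma Ck_on_subset (V W : normedModType R) k (U U' : set V) (f : V -> W) :
  U' `<=` U -> Ck_on k U f -> Ck_on k U' f.
Proof.
move=> UU'; elim: k f => [|k IH] f /=; first by move=> cf x /UU'/cf.
by move=> [df Df]; split=> [x /UU'/df //|v]; exact/IH/Df.
Qed.

Lemma Ck_on_add (V W : normedModType R) k (U : set V) (f g : V -> W) :
  open U -> Ck_on k U f -> Ck_on k U g -> Ck_on k U (fun x => f x + g x).
Proof.
move=> oU; elim: k f g => [|k IH] f g /=.
  by move=> cf cg x Ux; apply: continuousD; [exact: cf|exact: cg].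
move=> [df Df] [dg Dg]; split=> [x Ux|v].
  by apply: (@differentiableD _ _ _ f g); [exact: df|exact: dg].
apply: (eq_Ck_on oU _ (IH _ _ (Df v) (Dg v))) => x Ux.
by rewrite -(@deriveD _ _ _ f g) //; apply: diff_derivable; [exact: df|exact: dg].
Qed.

Lemma Ck_on_linl (V W Z : normedModType R) k (U : set V) (f : V -> W)
    (L : {linear W -> Z}) :
  continuous L -> open U -> Ck_on k U f -> Ck_on k U (fun x => L (f x)).
Proof.
move=> cL oU; elim: k f => [|k IH] f /=.
  by move=> cf x Ux; apply: continuous_comp; [exact: cf|exact: cL].
move=> [df Df]; split=> [x Ux|v].
  apply: (@differentiable_comp _ _ _ _ f L); first exact: df.
  exact: linear_differentiable.
apply: (eq_Ck_on oU _ (IH _ (Df v))) => x Ux.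
have dL y : differentiable L y by exact: linear_differentiable.
rewrite [RHS](deriveE (f := L \o f)); last first.
  exact: differentiable_comp (df _ Ux) (dL _).
rewrite diff_comp //=; last exact: df.
by rewrite diff_lin // deriveE //; exact: df.
Qed.

Lemma Ck_on_linr (V W Z : normedModType R) k (U : set W) (f : W -> Z)
    (L : {linear V -> W}) :
  continuous L -> Ck_on k U f -> Ck_on k (L @^-1` U) (fun x => f (L x)).
Proof.
move=> cL; elim: k f => [|k IH] f /=.
  by move=> cf x Ux; apply: continuous_comp; [exact: cL|exact: cf].
move=> [df Df]; split=> [x Ux|v].
  apply: (@differentiable_comp _ _ _ _ L f); last exact: df.
  exact: linear_differentiable.
have -> : (fun x => 'D_v (fun y => f (L y)) x) =
    (fun x => 'D_(L v) f (L x)); last exact: IH (Df (L v)).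
rewrite funeqE => x; rewrite /derive.
have E : (fun h : R => h^-1 *: (f (L (h *: v + x)) - f (L x))) =
    (fun h => h^-1 *: (f (h *: L v + L x) - f (L x))).
  by rewrite funeqE => h; rewrite linearP.
exact: (congr1 (fun F : R -> Z => lim (F h @[h --> 0^'])) E).
Qed.

End SmoothFacts.

Record chart (R : realType) (M : topologicalType) (m : nat) := Chart {
  chart_dom : set M;
  chart_map :> M -> 'rV[R]_m;
  chart_inv : 'rV[R]_m -> M;
  chart_dom_open : open chart_dom;
  chart_img_open : open (chart_map @` chart_dom);
  chart_mapK : forall p, chart_dom p -> chart_inv (chart_map p) = p;
  chart_map_continuous : forall p, chart_dom p -> {for p, continuous chart_map};
  chart_inv_continuous : forall x, (chart_map @` chart_dom) x ->
    {for x, continuous chart_inv} }.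

(* A smooth manifold given by a smooth atlas, not required to be maximal.     *)
(* chart_at p is a distinguished chart of the atlas around p, used below to   *)
(* represent tangent vectors at p by their components.                        *)
Record manifold (R : realType) (m : nat) := Manifold {
  manifold_sort :> topologicalType;
  manifold_hausdorff : hausdorff_space manifold_sort;
  manifold_second_countable : @second_countable manifold_sort;
  atlas : set (chart R manifold_sort m);
  chart_at : manifold_sort -> chart R manifold_sort m;
  chart_at_atlas : forall p, atlas (chart_at p);
  chart_at_dom : forall p, chart_dom (chart_at p) p;
  atlas_smooth : forall phi psi, atlas phi -> atlas psi ->
    smooth_on (phi @` (chart_dom phi `&` chart_dom psi))
              (psi \o chart_inv phi) }.

Section ProductManifold.
Context {R : realType}.

Lemma chart_img_openI (M : topologicalType) m (phi : chart R M m) (A : set M) :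
  open A -> open (phi @` (chart_dom phi `&` A)).
Proof.
move=> oA.
have -> : phi @` (chart_dom phi `&` A) =
    phi @` chart_dom phi `&` chart_inv phi @^-1` A.
  apply/seteqP; split=> [_ [p [dp Ap] <-]|x [[p dp <-]]].
    by split; [exists p|rewrite /= chart_mapK].
  by rewrite /= chart_mapK // => Ap; exists p.
rewrite openE => x [ix Ax]; apply: filterI.
  exact: open_nbhs_nbhs (conj (@chart_img_open _ _ _ phi) ix).
apply: (chart_inv_continuous ix).
exact: open_nbhs_nbhs (conj oA Ax).
Qed.

Definition row_inl m n (u : 'rV[R]_m) : 'rV[R]_(m + n) := row_mx u 0.
Definition row_inr m n (v : 'rV[R]_n) : 'rV[R]_(m + n) := row_mx 0 v.

Fact row_inl_linear m n : linear (@row_inl m n).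
Proof. by move=> a u v; rewrite /row_inl scale_row_mx add_row_mx scaler0 addr0. Qed.
Fact row_inr_linear m n : linear (@row_inr m n).
Proof. by move=> a u v; rewrite /row_inr scale_row_mx add_row_mx scaler0 addr0. Qed.

HB.instance Definition _ m n := GRing.isLinear.Build R 'rV[R]_m 'rV[R]_(m + n)
  *:%R (@row_inl m n) (@row_inl_linear m n).
HB.instance Definition _ m n := GRing.isLinear.Build R 'rV[R]_n 'rV[R]_(m + n)
  *:%R (@row_inr m n) (@row_inr_linear m n).

Lemma row_mxE m n (u : 'rV[R]_m) (v : 'rV[R]_n) :
  row_mx u v = row_inl n u + row_inr m v.
Proof. by rewrite /row_inl /row_inr add_row_mx addr0 add0r. Qed.

Lemma cvg_row_mx (T : Type) (F : set_system T) m n (f : T -> 'rV[R]_m)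
    (g : T -> 'rV[R]_n) (a : 'rV[R]_m) (b : 'rV[R]_n) : Filter F ->
  f @ F --> a -> g @ F --> b -> row_mx (f t) (g t) @[t --> F] --> row_mx a b.
Proof.
move=> FF fa gb A [P Pn PA].
have fP : nbhs a [set u : 'rV[R]_m | forall i j, P i (lshift n j) (u i j)].
  exists (fun i j => P i (lshift n j)) => // i j.
  by move: (Pn i (lshift n j)); rewrite row_mxEl.
have gP : nbhs b [set u : 'rV[R]_n | forall i j, P i (rshift m j) (u i j)].
  exists (fun i j => P i (rshift m j)) => // i j.
  by move: (Pn i (rshift m j)); rewrite row_mxEr.
have ffP : F [set t | forall i j, P i (lshift n j) (f t i j)] := fa _ fP.
have ggP : F [set t | forall i j, P i (rshift m j) (g t i j)] := gb _ gP.
change (F [set t | A (row_mx (f t) (g t))]).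
apply: (@filterS _ F FF _ _ _ (filterI ffP ggP)) => t [ft gt]; apply: PA => i j.
case: (split_ordP j) => k ->; first by rewrite row_mxEl; exact: (ft i k).
by rewrite row_mxEr; exact: (gt i k).
Qed.

Lemma row_inl_continuous m n : continuous (@row_inl m n).
Proof.
move=> u; apply: (@cvg_row_mx _ _ _ _ id (cst 0) _ _ (nbhs_filter u));
  [exact: cvg_id|exact: cvg_cst].
Qed.
Lemma row_inr_continuous m n : continuous (@row_inr m n).
Proof.
move=> u; apply: (@cvg_row_mx _ _ _ _ (cst 0) id _ _ (nbhs_filter u));
  [exact: cvg_cst|exact: cvg_id].
Qed.

Lemma open_setX (S T : topologicalType) (A : set S) (B : set T) :
  open A -> open B -> open (A `*` B).
Proof.
rewrite !openE => oA oB [a b] [/= /oA Aa /oB Bb].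
by exists (A, B) => //; split.
Qed.

Lemma hausdorff_setX (S T : topologicalType) :
  hausdorff_space S -> hausdorff_space T -> hausdorff_space (S * T)%type.
Proof.
move=> hS hT [a b] [c d] cl; congr pair.
  apply: hS => A B nA nB.
  have [||[x y] [/= []]] := cl (A `*` setT) (B `*` setT).
  - by exists (A, setT) => //; split=> //; exact: filterT.
  - by exists (B, setT) => //; split=> //; exact: filterT.
  by move=> Ax _ [Bx _]; exists x.
apply: hT => A B nA nB.
have [||[x y] [/= []]] := cl (setT `*` A) (setT `*` B).
- by exists (setT, A) => //; split=> //; exact: filterT.
- by exists (setT, B) => //; split=> //; exact: filterT.
by move=> _ Ay [_ By]; exists y.
Qed.

Lemma second_countable_setX (S T : topologicalType) :
  @second_countable S -> @second_countable T ->
  @second_countable (S * T)%type.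
Proof.
move=> [B cB [oB bB]] [C cC [oC bC]].
exists ((fun UV => UV.1 `*` UV.2) @` (B `*` C)).
  exact: sub_countable (card_image_le _ _) (countableX cB cC).
split=> [_ [[U V] [/= /oB oU /oC oV] <-]|[x y] A [[A1 A2] [/= nA1 nA2] AA]].
  exact: open_setX.
have [U [BU Ux] UA] := bB x A1 nA1; have [V [CV Vy] VA] := bC y A2 nA2.
exists (U `*` V); last by move=> [u v] [/= /UA ? /VA ?]; exact: AA.
by split; [exists (U, V)|].
Qed.

Section ProductChart.
Context (S T : topologicalType) (m n : nat) (phi : chart R S m) (psi : chart R T n).

Let pdom := chart_dom phi `*` chart_dom psi.
Let pmap (p : S * T) := row_mx (phi p.1) (psi p.2).
Let pinv (x : 'rV[R]_(m + n)) :=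
  (chart_inv phi (lsubmx x), chart_inv psi (rsubmx x)).

Fact prod_chart_imgE (A : set S) (B : set T) :
  pmap @` (A `*` B) =
  (lsubmx : 'rV[R]_(m + n) -> 'rV[R]_m) @^-1` (phi @` A) `&`
  (rsubmx : 'rV[R]_(m + n) -> 'rV[R]_n) @^-1` (psi @` B).
Proof.
apply/seteqP; split=> [_ [[p q] [/= Ap Bq] <-]|x [[p Ap pE] [q Bq qE]]].
  by split => /=; rewrite /pmap ?row_mxKl ?row_mxKr; [exists p|exists q].
by exists (p, q) => //=; rewrite /pmap /= pE qE hsubmxK.
Qed.

Fact prod_chart_dom_open : open pdom.
Proof. by apply: open_setX; exact: chart_dom_open. Qed.

Fact prod_chart_img_open : open (pmap @` pdom).
Proof.
rewrite prod_chart_imgE; apply: openI; apply: open_comp; try exact: chart_img_open.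
  by move=> x _; exact: continuous_lsubmx.
by move=> x _; exact: continuous_rsubmx.
Qed.

Fact prod_chart_mapK p : pdom p -> pinv (pmap p) = p.
Proof.
case: p => p q [/= dp dq].
by rewrite /pinv /pmap row_mxKl row_mxKr /= !chart_mapK.
Qed.

Fact prod_chart_map_continuous p : pdom p -> {for p, continuous pmap}.
Proof.
case: p => p q [/= dp dq]; apply: cvg_row_mx.
  by apply: (continuous_comp (f := fst) (g := phi));
    [exact: cvg_fst|exact: chart_map_continuous].
by apply: (continuous_comp (f := snd) (g := psi));
  [exact: cvg_snd|exact: chart_map_continuous].
Qed.

Fact prod_chart_inv_continuous x : (pmap @` pdom) x -> {for x, continuous pinv}.
Proof.
rewrite prod_chart_imgE => -[/= lx rx].
have cl : {for x, continuous (chart_inv phi \o lsubmx)}.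
  by apply: continuous_comp; [exact: continuous_lsubmx|exact: chart_inv_continuous].
have cr : {for x, continuous (chart_inv psi \o rsubmx)}.
  by apply: continuous_comp; [exact: continuous_rsubmx|exact: chart_inv_continuous].
exact: (cvg_pair cl cr).
Qed.

Definition prod_chart : chart R (S * T)%type (m + n) :=
  Chart prod_chart_dom_open prod_chart_img_open prod_chart_mapK
    prod_chart_map_continuous prod_chart_inv_continuous.

End ProductChart.

Context (m1 m2 : nat) (M1 : manifold R m1) (M2 : manifold R m2).

Definition prod_atlas : set (chart R (M1 * M2)%type (m1 + m2)) :=
  [set prod_chart phi psi | phi in @atlas _ _ M1 & psi in @atlas _ _ M2].

Fact prod_atlas_smooth phi psi : prod_atlas phi -> prod_atlas psi ->
  smooth_on (phi @` (chart_dom phi `&` chart_dom psi)) (psi \o chart_inv phi).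
Proof.
move=> [phi1 ph1 [phi2 ph2 <-]] [psi1 ps1 [psi2 ps2 <-]] k.
have -> : chart_dom (prod_chart phi1 phi2) `&` chart_dom (prod_chart psi1 psi2) =
    (chart_dom phi1 `&` chart_dom psi1) `*` (chart_dom phi2 `&` chart_dom psi2).
  by apply/seteqP; split=> -[p q] /= [[? ?] [? ?]].
rewrite prod_chart_imgE.
set U1 := phi1 @` _; set U2 := phi2 @` _.
have oU1 : open U1 by apply: chart_img_openI; exact: chart_dom_open.
have oU2 : open U2 by apply: chart_img_openI; exact: chart_dom_open.
have oU : open ((lsubmx : 'rV[R]_(m1 + m2) -> 'rV[R]_m1) @^-1` U1 `&`
                (rsubmx : 'rV[R]_(m1 + m2) -> 'rV[R]_m2) @^-1` U2).
  by apply: openI; apply: open_comp => // x _;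
    [exact: continuous_lsubmx|exact: continuous_rsubmx].
apply: (eq_Ck_on (f := fun x =>
    row_inl m2 ((psi1 \o chart_inv phi1) (lsubmx x)) +
    row_inr m1 ((psi2 \o chart_inv phi2) (rsubmx x))) oU).
  by move=> x _; rewrite -row_mxE.
apply: (Ck_on_add oU); apply: Ck_on_linl => //.
- exact: row_inl_continuous.
- apply: (@Ck_on_subset _ _ _ k _ _ _ (@subIsetl _ _ _)).
  apply: (Ck_on_linr (L := lsubmx)); first exact: continuous_lsubmx.
  exact: atlas_smooth.
- exact: row_inr_continuous.
- apply: (@Ck_on_subset _ _ _ k _ _ _ (@subIsetr _ _ _)).
  apply: (Ck_on_linr (L := rsubmx)); first exact: continuous_rsubmx.
  exact: atlas_smooth.
Qed.

Definition prod_chart_at (p : M1 * M2) : chart R (M1 * M2)%type (m1 + m2) :=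
  prod_chart (chart_at p.1) (chart_at p.2).

Fact prod_chart_at_atlas p : prod_atlas (prod_chart_at p).
Proof.
exists (chart_at p.1); first exact: chart_at_atlas.
by exists (chart_at p.2) => //; exact: chart_at_atlas.
Qed.

Fact prod_chart_at_dom p : chart_dom (prod_chart_at p) p.
Proof. by split; exact: chart_at_dom. Qed.

Definition prod_manifold : manifold R (m1 + m2) :=
  Manifold
    (hausdorff_setX (@manifold_hausdorff _ _ M1) (@manifold_hausdorff _ _ M2))
    (second_countable_setX (@manifold_second_countable _ _ M1)
                           (@manifold_second_countable _ _ M2))
    prod_chart_at_atlas prod_chart_at_dom prod_atlas_smooth.

End ProductManifold.

Section Tangent.
Context {R : realType} {m : nat} {M : manifold R m}.

(* A tangent vector at p is represented by its components in chart_at p; its  *)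
(* components in any other chart are obtained through the differential of     *)
(* the transition map.                                                        *)
Definition tangent (p : M) : Type := 'rV[R]_m.

HB.instance Definition _ p := Vector.copy (tangent p) 'rV[R]_m.

Definition vector_field : Type := forall p : M, tangent p.

Definition covector_field : Type := forall p : M, tangent p -> R.

Definition tensor2 : Type := forall p : M, tangent p -> tangent p -> R.

Definition components (phi : chart R M m) (p : M) (v : tangent p) : 'rV[R]_m :=
  'd (phi \o chart_inv (chart_at p)) (chart_at p p) v.

Definition coord_vector (phi : chart R M m) (i : 'I_m) : vector_field :=
  fun p => 'd (chart_at p \o chart_inv phi) (phi p) (delta_mx 0 i).

Definition smooth_function (f : M -> R) : Prop :=
  forall phi, atlas phi ->
    smooth_on (phi @` chart_dom phi) (f \o chart_inv phi).

Definition smooth_vector_field (U : set M) (X : vector_field) : Prop :=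
  forall phi, atlas phi ->
    smooth_on (phi @` (chart_dom phi `&` U))
      (fun x => components phi (X (chart_inv phi x))).

Definition differential (f : M -> R) : covector_field :=
  fun p => 'd (f \o chart_inv (chart_at p)) (chart_at p p).

(* The function X(f). *)
Definition derivation (X : vector_field) (f : M -> R) : M -> R :=
  fun p => differential f (X p).

Definition sym_prod (alpha beta : covector_field) : tensor2 :=
  fun p v w => alpha p v * beta p w + beta p v * alpha p w.

Definition tensor_norm (G : tensor2) (p : M) (v : tangent p) : R :=
  Num.sqrt (G p v v).

Definition local_frame (U : set M) (e : 'I_m -> vector_field) : Prop :=
  (forall i, smooth_vector_field U (e i)) /\
  (forall p, U p -> basis_of fullv [tuple e i p | i < m]).

Definition local_orthonormal_frame (G : tensor2) (U : set M)
    (e : 'I_m -> vector_field) : Prop :=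
  [/\ open U, local_frame U e &
      forall p, U p -> forall i j, G p (e i p) (e j p) = (i == j)%:R].

End Tangent.

Arguments vector_field {R m} M.
Arguments covector_field {R m} M.
Arguments tensor2 {R m} M.
Identity Coercion tensor2_fun : tensor2 >-> Funclass.

Record riemannian_metric (R : realType) (m : nat) (M : manifold R m) :=
  RiemannianMetric {
    metric_tensor :> tensor2 M;
    metric_tensor_sym : forall (p : M) (v w : tangent p),
      metric_tensor v w = metric_tensor w v;
    metric_tensor_linear : forall (p : M) (v : tangent p), scalar (metric_tensor v);
    metric_tensor_pos : forall (p : M) (v : tangent p), v != 0 ->
      0 < metric_tensor v v;
    metric_tensor_smooth : forall phi, atlas phi -> forall i j,
      smooth_on (phi @` chart_dom phi)
        (fun x => metric_tensor (coord_vector phi i (chart_inv phi x))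
                         (coord_vector phi j (chart_inv phi x))) }.

(* The g-gradient of f: the vector field with g(grad f, w) = df(w).           *)
Definition grad (R : realType) m (M : manifold R m) (g : riemannian_metric M)
    (f : M -> R) : vector_field M :=
  fun p => xget 0 [set v : tangent p |
    forall w, g p v w = differential f w].

HB.instance Definition _ (R : realType) m (M : manifold R m)
    (g : riemannian_metric M) (p : M) (v : tangent p) :=
  GRing.isLinear.Build R (tangent p) R *%R (metric_tensor g v) (@metric_tensor_linear _ _ _ g p v).

Lemma gradP (R : realType) m (M : manifold R m) (g : riemannian_metric M)
    (f : M -> R) (p : M) (w : tangent p) :
  g p (grad g f p) w = differential f w.
Proof.
move: w; apply: (@xgetPex (tangent p) 0 [set v | forall w, g p v w = differential f w]).
pose A : 'M[R]_m :=
  \matrix_(i, j) metric_tensor g (delta_mx 0 i : tangent p) (delta_mx 0 j : tangent p).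
have gA (v w : tangent p) : g p v w = ((v : 'rV_m) *m A *m (w : 'rV_m)^T) 0 0.
  rewrite mxE [in LHS](row_sum_delta (w : 'rV_m)) /= linear_sum.
  apply: eq_bigr => j _; rewrite linearZ /= mulrC; congr (_ * _); last by rewrite mxE.
  rewrite mxE metric_tensor_sym [in LHS](row_sum_delta (v : 'rV_m)) linear_sum.
  by apply: eq_bigr => i _; rewrite linearZ /= metric_tensor_sym; congr (_ * _); rewrite mxE.
have A_unit : A \in unitmx.
  rewrite -row_free_unit -kermx_eq0; apply/rowV0P => v /sub_kermxP vA.
  apply/eqP/negPn/negP => /(metric_tensor_pos g (p := p)).
  by rewrite gA vA mul0mx mxE ltxx.
pose d : 'rV[R]_m := \row_j differential f (delta_mx 0 j : tangent p).
exists (d *m invmx A) => w; rewrite gA mulmxKV //.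
rewrite mxE [in RHS](row_sum_delta (w : 'rV_m)) /differential linear_sum.
by apply: eq_bigr => j _; rewrite linearZ /= mulrC !mxE.
Qed.

Definition tdiff (R : realType) m n (M : manifold R m) (N : manifold R n)
    (F : M -> N) (p : M) (v : tangent p) : tangent (F p) :=
  'd (chart_at (F p) \o F \o chart_inv (chart_at p)) (chart_at p p) v.

Definition pullback (R : realType) m n (M : manifold R m) (N : manifold R n)
    (F : M -> N) (g : tensor2 N) : tensor2 M :=
  fun p v w => g (F p) (tdiff F v) (tdiff F w).

Section DoublyWarped.
Context {R : realType} {m1 m2 : nat}.
Context {M1 : manifold R m1} {M2 : manifold R m2}.

Local Notation M := (prod_manifold M1 M2).

Definition pr1 : M -> M1 := fst.
Definition pr2 : M -> M2 := snd.

(* The lifts X1^h and X2^v are determined by their images under d pr1, d pr2. *)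
Definition hlift (X1 : vector_field M1) : vector_field M :=
  fun p => xget 0 [set v : tangent p |
    tdiff pr1 v = X1 (pr1 p) /\ tdiff pr2 v = 0].

Definition vlift (X2 : vector_field M2) : vector_field M :=
  fun p => xget 0 [set v : tangent p |
    tdiff pr1 v = 0 /\ tdiff pr2 v = X2 (pr2 p)].

Definition hfun (f : M1 -> R) : M -> R := f \o pr1.
Definition vfun (f : M2 -> R) : M -> R := f \o pr2.

Definition grad_sqnorm m (N : manifold R m) (g : riemannian_metric N)
    (f : N -> R) : N -> R :=
  fun p => g p (grad g f p) (grad g f p).

Context (g1 : riemannian_metric M1) (g2 : riemannian_metric M2).
Context (f1 : M1 -> R) (f2 : M2 -> R) (c : R).

Definition warped_metric : tensor2 M := fun p v w =>
  (vfun f2 p) ^+ 2 * pullback pr1 g1 v w +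
  (hfun f1 p) ^+ 2 * pullback pr2 g2 v w +
  c * hfun f1 p * vfun f2 p *
    sym_prod (differential (hfun f1)) (differential (vfun f2)) v w.

Context (e1 : 'I_m1 -> vector_field M1) (e2 : 'I_m2 -> vector_field M2).

(* Writing the frame of M2 as e_{m1+1}, ..., e_{m1+m2}, the vector field      *)
(* e_{m1+1+j} is e2 j with j : 'I_m2; accordingly frame_A k and frame_T k are *)
(* the sums over the first k vector fields, and k = m2 is allowed.            *)
Definition frame_a (j : 'I_m2) : M2 -> R := derivation (e2 j) f2.

Definition frame_A (k : nat) : M2 -> R :=
  fun q => \sum_(i < m2 | (i < k)%N) frame_a i q ^+ 2.

Definition frame_T (k : nat) : vector_field M2 :=
  fun q => \sum_(i < m2 | (i < k)%N) frame_a i q *: e2 i q.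

Let b1 : M1 -> R := grad_sqnorm g1 f1.

Definition frame_u'_h (j : 'I_m1) : vector_field M :=
  fun p => (vfun f2 p)^-1 *: hlift (e1 j) p.

Definition frame_u'_v (j : 'I_m2) : vector_field M :=
  fun p =>
    (c * vfun (frame_a j) p /
      (1 - c ^+ 2 * hfun b1 p * vfun (frame_A j) p)) *:
      (- (vfun f2 p)^-1 *: hlift (grad g1 f1) p
       + (c * hfun b1 p / hfun f1 p) *: vlift (frame_T j) p)
    + (hfun f1 p)^-1 *: vlift (e2 j) p.

Definition frame_u' (j : 'I_(m1 + m2)) : vector_field M :=
  match fintype.split j with
  | inl i => frame_u'_h i
  | inr i => frame_u'_v i
  end.

Definition frame_u (j : 'I_(m1 + m2)) : vector_field M :=
  match fintype.split j with
  | inl i => frame_u' (lshift m2 i)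
  | inr i => fun p =>
      (tensor_norm warped_metric (frame_u' (rshift m1 i) p))^-1 *:
        frame_u' (rshift m1 i) p
  end.

End DoublyWarped.

Section LiftFacts.
Context {R : realType} {m1 m2 : nat}.
Context {M1 : manifold R m1} {M2 : manifold R m2}.
Local Notation M := (prod_manifold M1 M2).

Lemma tdiff_pr1 (p : M) (v : tangent p) : tdiff pr1 v = lsubmx (v : 'rV_(m1 + m2)).
Proof.
have cl : continuous (lsubmx : 'rV[R]_(m1 + m2) -> 'rV[R]_m1).
  exact: continuous_lsubmx.
have [|_ dE] := @near_eq_diff R 'rV[R]_(m1 + m2) 'rV[R]_m1 lsubmx
    (chart_at (pr1 p) \o pr1 \o chart_inv (chart_at p)) (chart_at p p) _
    (linear_differentiable _ cl).
  have := @prod_chart_img_open _ _ _ _ _ (chart_at p.1) (chart_at p.2).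
  rewrite prod_chart_imgE => oU.
  apply: (near_open oU); last by move=> x [/= [q dq <-] _] /=; rewrite chart_mapK.
  split; rewrite /= ?row_mxKl ?row_mxKr; [exists p.1|exists p.2] => //;
    exact: chart_at_dom.
by rewrite /tdiff dE diff_lin.
Qed.

Lemma tdiff_pr2 (p : M) (v : tangent p) : tdiff pr2 v = rsubmx (v : 'rV_(m1 + m2)).
Proof.
have cr : continuous (rsubmx : 'rV[R]_(m1 + m2) -> 'rV[R]_m2).
  exact: continuous_rsubmx.
have [|_ dE] := @near_eq_diff R 'rV[R]_(m1 + m2) 'rV[R]_m2 rsubmx
    (chart_at (pr2 p) \o pr2 \o chart_inv (chart_at p)) (chart_at p p) _
    (linear_differentiable _ cr).
  have := @prod_chart_img_open _ _ _ _ _ (chart_at p.1) (chart_at p.2).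
  rewrite prod_chart_imgE => oU.
  apply: (near_open oU); last by move=> x [/= _ [q dq <-]] /=; rewrite chart_mapK.
  split; rewrite /= ?row_mxKl ?row_mxKr; [exists p.1|exists p.2] => //;
    exact: chart_at_dom.
by rewrite /tdiff dE diff_lin.
Qed.

Lemma hliftE (X1 : vector_field M1) (p : M) :
  hlift X1 p = row_mx (X1 (pr1 p) : 'rV_m1) (0 : 'rV_m2).
Proof.
apply: xget_unique => [|v]; first by rewrite /= tdiff_pr1 tdiff_pr2 row_mxKl row_mxKr.
by rewrite /= tdiff_pr1 tdiff_pr2 => -[<- <-]; rewrite hsubmxK.
Qed.

Lemma vliftE (X2 : vector_field M2) (p : M) :
  vlift X2 p = row_mx (0 : 'rV_m1) (X2 (pr2 p) : 'rV_m2).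
Proof.
apply: xget_unique => [|v]; first by rewrite /= tdiff_pr1 tdiff_pr2 row_mxKl row_mxKr.
by rewrite /= tdiff_pr1 tdiff_pr2 => -[<- <-]; rewrite hsubmxK.
Qed.

End LiftFacts.

(* Main.v *)
(* On U1 * U2 write D_k = 1 - c^2 b1 A_k and K_j = c a_j / D_j.  Since A_k is a
   partial sum of the squares in b2 = sum_i a_i^2, the hypothesis
   c^2 b1 b2 < 1 gives D_k > 0.  The coefficient K_j is chosen so that the
   vertical vector u'_j is G-orthogonal to every horizontal vector.  Hence
   G(u'_j, u'_k) only involves the M2-part of u'_j, and as e_i(f2) = a_i and
   T_j = sum_(i < j) a_i e_i, it is 0 for j < k and D_(j+1) / D_j for j = k.
   An orthonormal family of m1 + m2 vectors is a basis, and u_j is smooth because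
   grad f1 and b1 are, by expansion in the frame of M1, polynomial in smooth
   quantities. *)
Require Import Defs.
From HB Require Import structures.
From mathcomp Require Import all_boot all_order all_algebra.
From mathcomp Require Import all_classical all_reals all_analysis.
From mathcomp Require Import ring.

Set Implicit Arguments.
Unset Strict Implicit.
Unset Printing Implicit Defensive.

Import Order.TTheory GRing.Theory Num.Theory.
Import numFieldNormedType.Exports.

Local Open Scope classical_set_scope.
Local Open Scope ring_scope.

(** * Calculus rules for C^k maps on an open set of a normed space *)

Section CkCalculus.
Context {R : realType}.

(** The product, inverse and square root rules at order k+1 keep undifferentiated factors; these are
    lowered to order k here before the induction hypothesis applies. *)
Lemma Ck_onW (V W : normedModType R) k (U : set V) (f : V -> W) :
  Ck_on k.+1 U f -> Ck_on k U f.
Proof.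
elim: k f => [|k IH] f [df Df]; first by move=> x /df/differentiable_continuous.
by split=> // v; exact: IH (Df v).
Qed.

Lemma Ck_on_cst (V W : normedModType R) k (U : set V) (a : W) :
  Ck_on k U (fun=> a).
Proof.
elim: k a => [|k IH] a /=; first by move=> x _; exact: cvg_cst.
split=> [x _|v]; first exact: differentiable_cst.
have -> : (fun x : V => 'D_v (fun=> a) x) = (fun=> 0 : W); last exact: IH.
by rewrite funeqE => x; exact: derive_cst.
Qed.

Lemma Ck_on_sum (V W : normedModType R) k (U : set V) (I : Type) (s : seq I)
    (P : pred I) (f : I -> V -> W) :
  open U -> (forall i, P i -> Ck_on k U (f i)) ->
  Ck_on k U (fun x => \sum_(i <- s | P i) f i x).
Proof.
move=> oU sf.
have -> : (fun x => \sum_(i <- s | P i) f i x) = \sum_(i <- s | P i) f i.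
  by rewrite funeqE => x; rewrite fct_sumE.
elim/big_ind: _ => [|g h sg sh|i Pi]; first exact: (Ck_on_cst _ _ 0).
  exact: Ck_on_add.
exact: sf.
Qed.

(** Induction on k through the Leibniz rule. Both functions are generalized, since the hypothesis is
    applied to the pairs (f, D_v g) and (g, D_v f). *)
Lemma Ck_on_mul (V : normedModType R) k (U : set V) (f g : V -> R) :
  open U -> Ck_on k U f -> Ck_on k U g -> Ck_on k U (fun x => f x * g x).
Proof.
move=> oU; elim: k f g => [|k IH] f g.
  by move=> cf cg x Ux; apply: continuousM; [exact: cf|exact: cg].
move=> sf sg; have [df Df] := sf; have [dg Dg] := sg.
split=> [x Ux|v]; first exact: differentiableM (df x Ux) (dg x Ux).
apply: (eq_Ck_on oU (f := fun x => f x * 'D_v g x + g x * 'D_v f x)); last first.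
  by apply: Ck_on_add => //; apply: IH;
    [exact: Ck_onW|exact: Dg|exact: Ck_onW|exact: Df].
move=> x Ux; rewrite [RHS](@deriveM _ _ f g) //; apply: diff_derivable.
  exact: df.
exact: dg.
Qed.

(** The derivative of 1/f is again built from 1/f, by products with D_v f, so the induction runs
    with f fixed. *)
Lemma Ck_on_inv (V : normedModType R) k (U : set V) (f : V -> R) :
  open U -> (forall x, U x -> f x != 0) -> Ck_on k U f ->
  Ck_on k U (fun x => (f x)^-1).
Proof.
move=> oU f0; elim: k => [|k IH].
  by move=> cf x Ux; apply: continuousV; [exact: f0|exact: cf].
move=> sf; have [df Df] := sf.
split=> [x Ux|v]; first exact: differentiableV (df x Ux) (f0 x Ux).
apply: (eq_Ck_on oU
    (f := fun x => -1 * ((f x)^-1 * (f x)^-1) * 'D_v f x)); last first.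
  have sV := IH (Ck_onW sf).
  apply: Ck_on_mul (Df v) => //; apply: Ck_on_mul => //; first exact: Ck_on_cst.
  exact: Ck_on_mul.
move=> x Ux; rewrite deriveV ?f0 //; last exact/diff_derivable/df.
by rewrite mulN1r -invfM -expr2.
Qed.

(** Same scheme as for the inverse, with derivative D_v f / (2 sqrt f). Strict positivity keeps f
    away from 0, where the root is not differentiable. *)
Lemma Ck_on_sqrt (V : normedModType R) k (U : set V) (f : V -> R) :
  open U -> (forall x, U x -> 0 < f x) -> Ck_on k U f ->
  Ck_on k U (fun x => Num.sqrt (f x)).
Proof.
move=> oU f0; elim: k => [|k IH].
  by move=> cf x Ux; apply: (continuous_comp (cf x Ux)); exact: sqrt_continuous.
move=> sf; have [df Df] := sf.
have sqrt_is (x : V) : U x -> is_derive (f x) 1 Num.sqrt (2 * Num.sqrt (f x))^-1.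
  by move=> Ux; exact/is_derive1_sqrt/f0.
have sqrt_diff (x : V) : U x -> differentiable (Num.sqrt : R -> R) (f x).
  by move=> /sqrt_is [dS _]; exact/derivable1_diffP.
split=> [x Ux|v].
  exact: (differentiable_comp (df x Ux) (sqrt_diff x Ux)).
apply: (eq_Ck_on oU
    (f := fun x => (2 * Num.sqrt (f x))^-1 * 'D_v f x)); last first.
  apply: Ck_on_mul (Df v) => //; apply: Ck_on_inv => //.
    by move=> x Ux; rewrite mulf_neq0 ?pnatr_eq0 // gt_eqF // sqrtr_gt0 f0.
  by apply: Ck_on_mul => //; [exact: Ck_on_cst|exact: IH (Ck_onW sf)].
move=> x Ux; have dC := differentiable_comp (df x Ux) (sqrt_diff x Ux).
rewrite [RHS](deriveE (f := Num.sqrt \o f)) //.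
rewrite (diff_comp (df x Ux) (sqrt_diff x Ux)) /= -(deriveE _ (df x Ux)).
have [dS sE] := sqrt_is x Ux.
(* The scalar D_v f is read as D_v f times the vector 1, so that linearity leaves the differential
   of the root at 1, which [sE] computes. *)
rewrite -[X in _ = 'd _ _ X]mulr1 -/(_ *: _) linearZ /=.
by rewrite -(deriveE _ (sqrt_diff x Ux)) sE; exact: mulrC.
Qed.

Lemma Ck_on_coord (V : normedModType R) k m n (U : set V) (F : V -> 'M[R]_(m, n))
    (i : 'I_m) (j : 'I_n) :
  open U -> Ck_on k U F -> Ck_on k U (fun x => F x i j).
Proof.
move=> oU sF.
have cL : linear (fun A : 'M[R]_(m, n) => A i j).
  by move=> a A B; rewrite !mxE.
pose L : {linear 'M[R]_(m, n) -> R} :=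
  HB.pack (fun A : 'M[R]_(m, n) => A i j) (GRing.isLinear.Build _ _ _ _ _ cL).
exact: (@Ck_on_linl _ _ _ _ _ U F L (@coord_continuous _ m n i j)).
Qed.

(** F is the sum of its coordinates carried by the continuous linear maps a -> a e_j. This reduces
    row-valued maps to scalar ones. *)
Lemma Ck_on_rowP (V : normedModType R) k n (U : set V) (F : V -> 'rV[R]_n) :
  open U -> (forall j, Ck_on k U (fun x => F x 0 j)) -> Ck_on k U F.
Proof.
move=> oU sF.
have -> : F = fun x => \sum_j (F x 0 j) *: (delta_mx 0 j : 'rV[R]_n).
  by rewrite funeqE => x; exact: row_sum_delta.
apply: Ck_on_sum => // j _.
have cL : linear (fun a : R => a *: (delta_mx 0 j : 'rV[R]_n)).
  by move=> a b d; rewrite scalerDl scalerA.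
pose L : {linear R -> 'rV[R]_n} :=
  HB.pack (fun a : R => a *: (delta_mx 0 j : 'rV[R]_n))
    (GRing.isLinear.Build _ _ _ _ _ cL).
exact: (@Ck_on_linl _ _ _ _ _ U _ L (@scalel_continuous _ _ (delta_mx 0 j))).
Qed.

Lemma Ck_on_scale (V : normedModType R) k n (U : set V) (a : V -> R)
    (F : V -> 'rV[R]_n) :
  open U -> Ck_on k U a -> Ck_on k U F -> Ck_on k U (fun x => a x *: F x).
Proof.
move=> oU sa sF; apply: Ck_on_rowP => // j.
apply: (eq_Ck_on oU (f := fun x => a x * F x 0 j)) => [x _|]; first by rewrite mxE.
by apply: Ck_on_mul => //; exact: Ck_on_coord.
Qed.

End CkCalculus.

(** * Smooth functions and vector fields over an open subset of a manifold *)

Section SmoothOn.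
Context {R : realType} {m : nat} {M : manifold R m}.
Implicit Types (U : set M) (f g : M -> R) (X Y : vector_field M).

(** A local form of [smooth_function]: quantities built from a local frame, such as a_j and A_k, are
    controlled only where the frame is. *)
Definition smooth_fun_on U f : Prop :=
  forall phi, atlas phi ->
    smooth_on (phi @` (chart_dom phi `&` U)) (f \o chart_inv phi).

Lemma smooth_function_on U f : smooth_function f -> smooth_fun_on U f.
Proof.
move=> sf phi aphi k; apply: Ck_on_subset (sf phi aphi k).
by apply: image_subset => p [].
Qed.

Lemma eq_smooth_fun_on U f g :
  open U -> (forall p, U p -> f p = g p) -> smooth_fun_on U f ->
  smooth_fun_on U g.
Proof.
move=> oU fg sf phi aphi k; apply: eq_Ck_on (sf phi aphi k).
  exact: chart_img_openI.
by move=> _ [p [dp Up] <-] /=; rewrite chart_mapK // fg.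
Qed.

Lemma smooth_fun_on_cst U (a : R) : smooth_fun_on U (fun=> a).
Proof. by move=> phi _ k; exact: Ck_on_cst. Qed.

Lemma smooth_fun_onD U f g : open U -> smooth_fun_on U f -> smooth_fun_on U g ->
  smooth_fun_on U (fun p => f p + g p).
Proof.
move=> oU sf sg phi aphi k; apply: Ck_on_add; first exact: chart_img_openI.
  exact: sf.
exact: sg.
Qed.

Lemma smooth_fun_onM U f g : open U -> smooth_fun_on U f -> smooth_fun_on U g ->
  smooth_fun_on U (fun p => f p * g p).
Proof.
move=> oU sf sg phi aphi k; apply: Ck_on_mul; first exact: chart_img_openI.
  exact: sf.
exact: sg.
Qed.

Lemma smooth_fun_on_sum U (I : Type) (s : seq I) (P : pred I) (f : I -> M -> R) :
  open U -> (forall i, P i -> smooth_fun_on U (f i)) ->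
  smooth_fun_on U (fun p => \sum_(i <- s | P i) f i p).
Proof.
move=> oU sf phi aphi k.
by apply: Ck_on_sum => [|i Pi]; [exact: chart_img_openI|exact: sf].
Qed.

Lemma smooth_fun_onV U f : open U -> (forall p, U p -> f p != 0) ->
  smooth_fun_on U f -> smooth_fun_on U (fun p => (f p)^-1).
Proof.
move=> oU f0 sf phi aphi k; apply: Ck_on_inv (sf phi aphi k).
  exact: chart_img_openI.
by move=> _ [p [dp Up] <-] /=; rewrite chart_mapK // f0.
Qed.

Lemma smooth_fun_on_sqrt U f : open U -> (forall p, U p -> 0 < f p) ->
  smooth_fun_on U f -> smooth_fun_on U (fun p => Num.sqrt (f p)).
Proof.
move=> oU f0 sf phi aphi k; apply: Ck_on_sqrt (sf phi aphi k).
  exact: chart_img_openI.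
by move=> _ [p [dp Up] <-] /=; rewrite chart_mapK // f0.
Qed.

Lemma eq_smooth_vector_field U X Y :
  open U -> (forall p, U p -> X p = Y p) -> smooth_vector_field U X ->
  smooth_vector_field U Y.
Proof.
move=> oU XY sX phi aphi k; apply: eq_Ck_on (sX phi aphi k).
  exact: chart_img_openI.
by move=> _ [p [dp Up] <-]; rewrite chart_mapK // XY.
Qed.

(** At each point [components phi] is a differential, hence linear, so the algebra of vector fields
    passes to their components. *)
Lemma smooth_vector_fieldD U X Y :
  open U -> smooth_vector_field U X -> smooth_vector_field U Y ->
  smooth_vector_field U (fun p => X p + Y p).
Proof.
move=> oU sX sY phi aphi k.
apply: (eq_Ck_on (chart_img_openI oU) (f := fun x =>
    components phi (X (chart_inv phi x)) + components phi (Y (chart_inv phi x)))).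
  by move=> x _; rewrite /components linearD.
apply: Ck_on_add; [exact: chart_img_openI|exact: sX|exact: sY].
Qed.

Lemma smooth_vector_fieldZ U f X :
  open U -> smooth_fun_on U f -> smooth_vector_field U X ->
  smooth_vector_field U (fun p => f p *: X p).
Proof.
move=> oU sf sX phi aphi k.
apply: (eq_Ck_on (chart_img_openI oU) (f := fun x =>
    f (chart_inv phi x) *: components phi (X (chart_inv phi x)))).
  by move=> x _; rewrite /components linearZ.
apply: Ck_on_scale; [exact: chart_img_openI|exact: sf|exact: sX].
Qed.

Lemma smooth_vector_field0 U : smooth_vector_field U (fun=> 0).
Proof.
move=> phi _ k.
have -> : (fun x => components phi (0 : tangent (chart_inv phi x))) = (fun=> 0).
  by rewrite funeqE => x; rewrite /components linear0.
exact: Ck_on_cst.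
Qed.

Lemma smooth_vector_field_sum U (I : Type) (s : seq I) (P : pred I)
    (X : I -> vector_field M) :
  open U -> (forall i, P i -> smooth_vector_field U (X i)) ->
  smooth_vector_field U (fun p => \sum_(i <- s | P i) X i p).
Proof.
move=> oU sX; elim: s => [|i s IH].
  apply: eq_smooth_vector_field (smooth_vector_field0 U) => // p _.
  by rewrite big_nil.
case Pi: (P i); last first.
  by apply: eq_smooth_vector_field IH => // p _; rewrite big_cons Pi.
apply: eq_smooth_vector_field (smooth_vector_fieldD oU (sX i Pi) IH) => // p _.
by rewrite big_cons Pi.
Qed.

Lemma differentiable_transition (phi : chart R M m) (p : M) :
  atlas phi -> chart_dom phi p ->
  differentiable (phi \o chart_inv (chart_at p)) (chart_at p p).
Proof.
move=> aphi dp; have [+ _] := atlas_smooth (chart_at_atlas p) aphi 1.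
by apply; exists p => //; split=> //; exact: chart_at_dom.
Qed.

Lemma differentiable_in_chart (phi : chart R M m) f (p : M) :
  smooth_function f -> atlas phi -> chart_dom phi p ->
  differentiable (f \o chart_inv phi) (phi p).
Proof. by move=> sf aphi dp; have [+ _] := sf phi aphi 1; apply; exists p. Qed.

(** [differential] is defined in the distinguished chart at p, while smoothness is tested in every
    chart of the atlas; the chain rule along the transition map links the two. *)
Lemma differential_components (phi : chart R M m) f (p : M) (v : tangent p) :
  smooth_function f -> atlas phi -> chart_dom phi p ->
  differential f v = 'd (f \o chart_inv phi) (phi p) (components phi v).
Proof.
move=> sf aphi dp; have dt := differentiable_transition aphi dp.
have ptK : chart_inv (chart_at p) (chart_at p p) = p.
  by rewrite chart_mapK //; exact: chart_at_dom.
have df : differentiable (f \o chart_inv phi)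
    ((phi \o chart_inv (chart_at p)) (chart_at p p)).
  by rewrite /= ptK; exact: differentiable_in_chart.
(* Chart inverses cancel only on the overlap of the two domains, so the two expressions of f agree
   near the point and not everywhere. *)
have nE : {near chart_at p p, (f \o chart_inv phi) \o
    (phi \o chart_inv (chart_at p)) =1 f \o chart_inv (chart_at p)}.
  apply: (near_open (U := chart_at p @` (chart_dom (chart_at p) `&` chart_dom phi))).
  - by apply: chart_img_openI; exact: chart_dom_open.
  - by exists p => //; split=> //; exact: chart_at_dom.
  - by move=> _ [q [dq dq'] <-] /=; rewrite !chart_mapK // chart_mapK.
have [_ dE] := near_eq_diff nE (differentiable_comp dt df).
have tE : phi p = (phi \o chart_inv (chart_at p)) (chart_at p p) by rewrite /= ptK.
rewrite tE -[RHS]/((_ \o 'd (phi \o chart_inv (chart_at p)) (chart_at p p)) v).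
by rewrite -(diff_comp dt df) /differential dE.
Qed.

(** In a chart, X(f) is the sum of the components of X times the partial derivatives of f. *)
Lemma smooth_derivation U X f :
  open U -> smooth_vector_field U X -> smooth_function f ->
  smooth_fun_on U (derivation X f).
Proof.
move=> oU sX sf phi aphi k; have oI := chart_img_openI (phi := phi) oU.
apply: (eq_Ck_on oI (f := fun x => \sum_j
    components phi (X (chart_inv phi x)) 0 j *
    'D_(delta_mx 0 j) (f \o chart_inv phi) x)).
  move=> _ [p [dp Up] <-]; rewrite /= /derivation.
  rewrite (differential_components _ sf aphi) chart_mapK //.
  rewrite [in RHS](row_sum_delta (components phi (X p))) linear_sum.
  apply: eq_bigr => j _; rewrite linearZ; congr (_ * _).
  by rewrite deriveE //; exact: differentiable_in_chart.
apply: Ck_on_sum => // j _; apply: Ck_on_mul => //.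
  by apply: Ck_on_coord => //; exact: sX.
(* One order is lost by differentiating, hence order k+1 for f. *)
have [_ Df] := sf phi aphi k.+1.
apply: Ck_on_subset (Df (delta_mx 0 j)).
by apply: image_subset => p [].
Qed.

End SmoothOn.

(** * Product charts, lifts of functions and vector fields, and their differentials *)

Section SmoothProduct.
Context {R : realType} {m1 m2 : nat} {M1 : manifold R m1} {M2 : manifold R m2}.
Local Notation M := (prod_manifold M1 M2).

Lemma prod_chart_dom_setI (phi1 : chart R M1 m1) (phi2 : chart R M2 m2)
    (U1 : set M1) (U2 : set M2) :
  chart_dom (prod_chart phi1 phi2) `&` (U1 `*` U2) =
  (chart_dom phi1 `&` U1) `*` (chart_dom phi2 `&` U2).
Proof. by apply/seteqP; split=> -[p q] /= [[? ?] [? ?]]. Qed.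

(** The product chart maps a product set into the preimage, under the linear projection [lsubmx], of
    its image in the first factor. *)
Lemma Ck_on_lsubmx (W : normedModType R) k (phi1 : chart R M1 m1)
    (phi2 : chart R M2 m2) (U1 : set M1) (U2 : set M2) (F : 'rV[R]_m1 -> W) :
  Ck_on k (phi1 @` (chart_dom phi1 `&` U1)) F ->
  Ck_on k (prod_chart phi1 phi2 @`
           (chart_dom (prod_chart phi1 phi2) `&` (U1 `*` U2)))
    (fun x : 'rV[R]_(m1 + m2) => F (lsubmx x)).
Proof.
move=> sF; rewrite prod_chart_dom_setI prod_chart_imgE.
apply: (@Ck_on_subset _ _ _ k _ _ _ (@subIsetl _ _ _)).
by apply: (Ck_on_linr (L := lsubmx)); first exact: continuous_lsubmx.
Qed.

Lemma Ck_on_rsubmx (W : normedModType R) k (phi1 : chart R M1 m1)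
    (phi2 : chart R M2 m2) (U1 : set M1) (U2 : set M2) (F : 'rV[R]_m2 -> W) :
  Ck_on k (phi2 @` (chart_dom phi2 `&` U2)) F ->
  Ck_on k (prod_chart phi1 phi2 @`
           (chart_dom (prod_chart phi1 phi2) `&` (U1 `*` U2)))
    (fun x : 'rV[R]_(m1 + m2) => F (rsubmx x)).
Proof.
move=> sF; rewrite prod_chart_dom_setI prod_chart_imgE.
apply: (@Ck_on_subset _ _ _ k _ _ _ (@subIsetr _ _ _)).
by apply: (Ck_on_linr (L := rsubmx)); first exact: continuous_rsubmx.
Qed.

Lemma smooth_hfun (U1 : set M1) (U2 : set M2) (f : M1 -> R) :
  smooth_fun_on U1 f -> smooth_fun_on (M := M) (U1 `*` U2) (hfun f).
Proof.
move=> sf _ [phi1 a1 [phi2 a2 <-]] k.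
exact: (@Ck_on_lsubmx _ k phi1 phi2 U1 U2 (f \o chart_inv phi1) (sf phi1 a1 k)).
Qed.

Lemma smooth_vfun (U1 : set M1) (U2 : set M2) (f : M2 -> R) :
  smooth_fun_on U2 f -> smooth_fun_on (M := M) (U1 `*` U2) (vfun f).
Proof.
move=> sf _ [phi1 a1 [phi2 a2 <-]] k.
exact: (@Ck_on_rsubmx _ k phi1 phi2 U1 U2 (f \o chart_inv phi2) (sf phi2 a2 k)).
Qed.

(** The transition map between product charts is the direct sum of the transition maps of the
    factors, so its differential is block diagonal. *)
Lemma components_prod_chart (phi1 : chart R M1 m1) (phi2 : chart R M2 m2)
    (p : M) (v : tangent p) :
  atlas phi1 -> atlas phi2 -> chart_dom (prod_chart phi1 phi2) p ->
  components (M := M) (prod_chart phi1 phi2) v =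
  row_mx (components phi1 (lsubmx (v : 'rV_(m1 + m2)) : tangent p.1))
         (components phi2 (rsubmx (v : 'rV_(m1 + m2)) : tangent p.2)).
Proof.
move=> a1 a2 [d1 d2].
pose l : 'rV[R]_(m1 + m2) -> 'rV[R]_m1 := lsubmx.
pose r : 'rV[R]_(m1 + m2) -> 'rV[R]_m2 := rsubmx.
pose x := chart_at p p.
have xl : l x = chart_at p.1 p.1 by exact: row_mxKl.
have xr : r x = chart_at p.2 p.2 by exact: row_mxKr.
pose F1 := phi1 \o chart_inv (chart_at p.1).
pose F2 := phi2 \o chart_inv (chart_at p.2).
have dF1 : differentiable F1 (l x).
  by rewrite xl; exact: differentiable_transition.
have dF2 : differentiable F2 (r x).
  by rewrite xr; exact: differentiable_transition.
have cl : continuous l by exact: continuous_lsubmx.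
have cr : continuous r by exact: continuous_rsubmx.
have dl y : differentiable l y by exact: linear_differentiable.
have dr y : differentiable r y by exact: linear_differentiable.
have dil y : differentiable (@row_inl R m1 m2) y.
  by apply: linear_differentiable; exact: row_inl_continuous.
have dir y : differentiable (@row_inr R m1 m2) y.
  by apply: linear_differentiable; exact: row_inr_continuous.
have d1l := differentiable_comp (dl x) dF1.
have d2r := differentiable_comp (dr x) dF2.
have D1 := differentiable_comp d1l (dil _).
have D2 := differentiable_comp d2r (dir _).
have E : prod_chart phi1 phi2 \o chart_inv (chart_at p) =
    (@row_inl R m1 m2 \o (F1 \o l)) + (@row_inr R m1 m2 \o (F2 \o r)).
  by rewrite funeqE => y; exact: row_mxE.
have dE1 : 'd (@row_inl R m1 m2 \o (F1 \o l)) x =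
    @row_inl R m1 m2 \o ('d F1 (l x) \o l) :> (_ -> _).
  rewrite (diff_comp d1l (dil _)) (diff_comp (dl x) dF1) (diff_lin _ cl).
  by rewrite (diff_lin _ (@row_inl_continuous R m1 m2)).
have dE2 : 'd (@row_inr R m1 m2 \o (F2 \o r)) x =
    @row_inr R m1 m2 \o ('d F2 (r x) \o r) :> (_ -> _).
  rewrite (diff_comp d2r (dir _)) (diff_comp (dr x) dF2) (diff_lin _ cr).
  by rewrite (diff_lin _ (@row_inr_continuous R m1 m2)).
(* Generalizing the map to [g] lets [E] act by substitution rather than by rewriting under the
   differential. *)
suff dE g :
    g = (@row_inl R m1 m2 \o (F1 \o l)) + (@row_inr R m1 m2 \o (F2 \o r)) ->
    'd g x v = row_inl m2 ('d F1 (l x) (l v)) + row_inr m1 ('d F2 (r x) (r v)).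
  by have := dE _ E; rewrite xl xr -row_mxE.
move=> ->; rewrite (diffD D1 D2); congr (_ + _).
  exact: (congr1 (fun h => h v) dE1).
exact: (congr1 (fun h => h v) dE2).
Qed.

(** In a product chart the lift has the components of X in the first block and 0 in the second. *)
Lemma smooth_hlift (U1 : set M1) (U2 : set M2) (X : vector_field M1) :
  open U1 -> open U2 ->
  smooth_vector_field U1 X -> smooth_vector_field (M := M) (U1 `*` U2) (hlift X).
Proof.
move=> oU1 oU2 sX _ [phi1 a1 [phi2 a2 <-]] k.
have oI := chart_img_openI (phi := prod_chart phi1 phi2) (open_setX oU1 oU2).
apply: (eq_Ck_on oI (f := fun x => row_inl m2
    ((fun y => components phi1 (X (chart_inv phi1 y))) (lsubmx x)))).
  move=> _ [p [dp Up] <-]; rewrite chart_mapK // components_prod_chart //.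
  rewrite hliftE row_mxKl row_mxKr /components linear0.
  by case: dp => dp _; rewrite /= row_mxKl chart_mapK.
apply: Ck_on_linl => //; first exact: row_inl_continuous.
exact: Ck_on_lsubmx (sX phi1 a1 k).
Qed.

Lemma smooth_vlift (U1 : set M1) (U2 : set M2) (X : vector_field M2) :
  open U1 -> open U2 ->
  smooth_vector_field U2 X -> smooth_vector_field (M := M) (U1 `*` U2) (vlift X).
Proof.
move=> oU1 oU2 sX _ [phi1 a1 [phi2 a2 <-]] k.
have oI := chart_img_openI (phi := prod_chart phi1 phi2) (open_setX oU1 oU2).
apply: (eq_Ck_on oI (f := fun x => row_inr m1
    ((fun y => components phi2 (X (chart_inv phi2 y))) (rsubmx x)))).
  move=> _ [p [dp Up] <-]; rewrite chart_mapK // components_prod_chart //.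
  rewrite vliftE row_mxKl row_mxKr /components linear0.
  by case: dp => _ dp; rewrite /= row_mxKr chart_mapK.
apply: Ck_on_linl => //; first exact: row_inr_continuous.
exact: Ck_on_rsubmx (sX phi2 a2 k).
Qed.

Lemma differential_hfun (f : M1 -> R) (p : M) (v : tangent p) :
  smooth_function f ->
  differential (hfun f) v = differential f (lsubmx (v : 'rV_(m1 + m2)) : tangent p.1).
Proof.
move=> sf; pose l : 'rV[R]_(m1 + m2) -> 'rV[R]_m1 := lsubmx.
have cl : continuous l by exact: continuous_lsubmx.
have dl y : differentiable l y by exact: linear_differentiable.
have xl : l (chart_at p p) = chart_at p.1 p.1 by exact: row_mxKl.
have df : differentiable (f \o chart_inv (chart_at p.1)) (l (chart_at p p)).
  by rewrite xl; apply: differentiable_in_chart => //;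
    [exact: chart_at_atlas|exact: chart_at_dom].
have dE := diff_comp (dl _) df.
rewrite (diff_lin _ cl) xl in dE.
(* Read in the chart at p, [hfun f] is convertible to the composition with [l] that [dE]
   differentiates. *)
exact: (congr1 (fun h => h v) dE).
Qed.

Lemma differential_vfun (f : M2 -> R) (p : M) (v : tangent p) :
  smooth_function f ->
  differential (vfun f) v = differential f (rsubmx (v : 'rV_(m1 + m2)) : tangent p.2).
Proof.
move=> sf; pose r : 'rV[R]_(m1 + m2) -> 'rV[R]_m2 := rsubmx.
have cr : continuous r by exact: continuous_rsubmx.
have dr y : differentiable r y by exact: linear_differentiable.
have xr : r (chart_at p p) = chart_at p.2 p.2 by exact: row_mxKr.
have df : differentiable (f \o chart_inv (chart_at p.2)) (r (chart_at p p)).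
  by rewrite xr; apply: differentiable_in_chart => //;
    [exact: chart_at_atlas|exact: chart_at_dom].
have dE := diff_comp (dr _) df.
rewrite (diff_lin _ cr) xr in dE.
exact: (congr1 (fun h => h v) dE).
Qed.

End SmoothProduct.

(** * Gradients in an orthonormal frame *)

Section OrthonormalFrame.
Context {R : realType} {m : nat} {M : manifold R m} (g : riemannian_metric M).
Context (U : set M) (e : 'I_m -> vector_field M).
Hypothesis e_frame : local_orthonormal_frame g U e.

(** The linear structure of a metric is declared in its second argument; symmetry carries it to the
    first, here and in the next lemmas. *)
Lemma metric_tensorDl (p : M) (u v w : tangent p) : g p (u + v) w = g p u w + g p v w.
Proof. by rewrite metric_tensor_sym linearD /= !(metric_tensor_sym _ w). Qed.

Lemma metric_tensor0l (p : M) (w : tangent p) : g p 0 w = 0.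
Proof. by rewrite metric_tensor_sym linear0. Qed.

Lemma metric_tensorZl (p : M) (a : R) (v w : tangent p) :
  g p (a *: v) w = a * g p v w.
Proof. by rewrite metric_tensor_sym linearZ /= (metric_tensor_sym _ w). Qed.

Lemma metric_tensor_suml (p : M) (I : Type) (s : seq I) (P : pred I)
    (v : I -> tangent p) (w : tangent p) :
  g p (\sum_(i <- s | P i) v i) w = \sum_(i <- s | P i) g p (v i) w.
Proof.
rewrite metric_tensor_sym linear_sum /=.
by apply: eq_bigr => i _; exact: metric_tensor_sym.
Qed.

Lemma metric_tensor_frame (p : M) i j : U p -> g p (e i p) (e j p) = (i == j)%:R.
Proof. by case: e_frame => _ _ eo /eo ->. Qed.

Lemma frame_expansion (p : M) (v : tangent p) : U p ->
  v = \sum_i g p v (e i p) *: e i p.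
Proof.
move=> Up; have [_ [_ /(_ _ Up) eb] _] := e_frame.
have vE : v = \sum_i coord [tuple e i p | i < m] i v *: e i p.
  rewrite {1}(coord_basis eb (memvf v)); apply: eq_bigr => i _.
  by rewrite -tnth_nth tnth_mktuple.
rewrite [LHS]vE; apply: eq_bigr => i _; congr (_ *: _).
(* Only the v inside the metric is expanded; pairing with e_i then isolates its i-th coordinate. *)
rewrite {2}vE metric_tensor_suml (bigD1 i) //= big1 => [|j ji].
  by rewrite metric_tensorZl metric_tensor_frame // eqxx mulr1 addr0.
by rewrite metric_tensorZl metric_tensor_frame // (negbTE ji) mulr0.
Qed.

(** [grad] is chosen point by point, which says nothing of its regularity; this expansion, with
    coefficients g(grad f, e_i) = e_i(f), yields smoothness over [U]. *)
Lemma grad_frame (f : M -> R) (p : M) : U p ->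
  grad g f p = \sum_i derivation (e i) f p *: e i p.
Proof.
move=> Up; rewrite [LHS](frame_expansion _ Up).
by apply: eq_bigr => i _; rewrite gradP.
Qed.

(** One gradient turns the square norm into df(grad f), the other is expanded in the frame. For f2
    this makes b2 the full sum of which A_k is a part. *)
Lemma grad_sqnorm_frame (f : M -> R) (p : M) : U p ->
  grad_sqnorm g f p = \sum_i derivation (e i) f p ^+ 2.
Proof.
move=> Up; rewrite /grad_sqnorm gradP {1}(grad_frame _ Up) /differential linear_sum.
by apply: eq_bigr => i _; rewrite linearZ.
Qed.

Lemma smooth_grad (f : M -> R) :
  smooth_function f -> smooth_vector_field U (grad g f).
Proof.
move=> sf; have [oU [se _] _] := e_frame.
apply: (eq_smooth_vector_field oU
    (X := fun p => \sum_i derivation (e i) f p *: e i p)).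
  by move=> p Up; rewrite grad_frame.
apply: smooth_vector_field_sum => // i _; apply: smooth_vector_fieldZ => //.
exact: smooth_derivation.
Qed.

Lemma smooth_grad_sqnorm (f : M -> R) :
  smooth_function f -> smooth_fun_on U (grad_sqnorm g f).
Proof.
move=> sf; have [oU [se _] _] := e_frame.
apply: (eq_smooth_fun_on oU
    (f := fun p => \sum_i derivation (e i) f p * derivation (e i) f p)).
  by move=> p Up; rewrite grad_sqnorm_frame.
apply: smooth_fun_on_sum => // i _.
by apply: smooth_fun_onM => //; exact: smooth_derivation.
Qed.

End OrthonormalFrame.

(** * Positivity, orthonormal families and linearity of differentials *)

Lemma grad_sqnorm_ge0 (R : realType) m (M : manifold R m)
    (g : riemannian_metric M) (f : M -> R) (p : M) : 0 <= grad_sqnorm g f p.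
Proof.
rewrite /grad_sqnorm; have [->|/(metric_tensor_pos g)/ltW //] := eqVneq (grad g f p) 0.
by rewrite linear0.
Qed.

(** Pairing a vanishing combination with u_i kills its i-th coefficient, and n free vectors span
    dimension n. The form is a bare function because [warped_metric] is only a [tensor2]. *)
Lemma orthonormal_basis (R : realType) n (G : 'rV[R]_n -> 'rV[R]_n -> R)
    (u : 'I_n -> 'rV[R]_n) :
  (forall v, scalar (G v)) -> (forall i j, G (u i) (u j) = (i == j)%:R) ->
  basis_of fullv [tuple u i | i < n].
Proof.
move=> lG uo; rewrite basisEfree subvf size_tuple dimvf dim_matrix mul1r leqnn !andbT.
apply/freeP => k k0 i.
pose L : {scalar 'rV[R]_n} :=
  HB.pack (G (u i)) (GRing.isLinear.Build _ _ _ _ _ (lG (u i))).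
have := congr1 L k0; rewrite linear0 linear_sum (bigD1 i) // big1 => [|j ji].
  rewrite -tnth_nth tnth_mktuple linearZ /= addr0 uo eqxx => <-.
  by rewrite mulr1.
by rewrite -tnth_nth tnth_mktuple linearZ /= uo eq_sym (negbTE ji) mulr0.
Qed.

Lemma differential_linear (R : realType) m (M : manifold R m) (f : M -> R)
    (p : M) : scalar (@differential _ _ M f p).
Proof. by move=> a v w; rewrite /differential linearP. Qed.

HB.instance Definition _ (R : realType) m (M : manifold R m) (f : M -> R) (p : M) :=
  GRing.isLinear.Build R (tangent p) R *%R (@differential _ _ M f p)
    (@differential_linear _ _ M f p).

(** * The warped metric in block form *)

Section WarpedFrame.
Context {R : realType} {m1 m2 : nat} {M1 : manifold R m1} {M2 : manifold R m2}.
Context (g1 : riemannian_metric M1) (g2 : riemannian_metric M2).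
Context (f1 : M1 -> R) (f2 : M2 -> R) (c : R).
Hypotheses (f1_smooth : smooth_function f1) (f2_smooth : smooth_function f2).

Local Notation M := (prod_manifold M1 M2).
Local Notation G := (@warped_metric _ _ _ _ _ g1 g2 f1 f2 c _).
Local Notation b1 := (grad_sqnorm g1 f1).
Local Notation b2 := (grad_sqnorm g2 f2).

(** The projections have differentials [lsubmx] and [rsubmx], and each lifted function sees one
    block only. The inner products below are computed from this formula. *)
Lemma warped_metricE (p : M) (v1 w1 : tangent p.1) (v2 w2 : tangent p.2) :
  @warped_metric _ _ _ _ _ g1 g2 f1 f2 c p (row_mx v1 v2) (row_mx w1 w2) =
  f2 p.2 ^+ 2 * g1 p.1 v1 w1 + f1 p.1 ^+ 2 * g2 p.2 v2 w2 +
  c * f1 p.1 * f2 p.2 * (differential f1 v1 * differential f2 w2 +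
                         differential f2 v2 * differential f1 w1).
Proof.
rewrite /warped_metric /pullback /sym_prod !tdiff_pr1 !tdiff_pr2.
by rewrite !differential_hfun // !differential_vfun // !row_mxKl !row_mxKr.
Qed.

Lemma warped_metric_sym (p : M) (v w : tangent p) : G v w = G w v.
Proof.
rewrite /warped_metric /pullback /sym_prod.
rewrite (metric_tensor_sym g1) (metric_tensor_sym g2); congr (_ + _ * _).
by rewrite addrC mulrC [X in _ + X]mulrC.
Qed.

Lemma warped_metric_linear (p : M) (v : tangent p) : scalar (G v).
Proof.
move=> a w w'; rewrite /warped_metric /pullback /sym_prod.
rewrite !tdiff_pr1 !tdiff_pr2 !differential_hfun // !differential_vfun //.
have -> : lsubmx (a *: w + w' : 'rV_(m1 + m2)) =
    a *: lsubmx (w : 'rV_(m1 + m2)) + lsubmx (w' : 'rV_(m1 + m2)) by exact: linearP.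
have -> : rsubmx (a *: w + w' : 'rV_(m1 + m2)) =
    a *: rsubmx (w : 'rV_(m1 + m2)) + rsubmx (w' : 'rV_(m1 + m2)) by exact: linearP.
rewrite (metric_tensor_linear g1) (metric_tensor_linear g2) !differential_linear.
ring.
Qed.

(** * The partial sums A_k and T_k, and the denominators D_k *)

Context (U1 : set M1) (U2 : set M2).
Context (e1 : 'I_m1 -> vector_field M1) (e2 : 'I_m2 -> vector_field M2).
Hypotheses (e1_frame : local_orthonormal_frame g1 U1 e1)
           (e2_frame : local_orthonormal_frame g2 U2 e2).
Hypotheses (f1_gt0 : forall p, 0 < f1 p) (f2_gt0 : forall q, 0 < f2 q).
Hypothesis cb_lt1 : forall p : M, 0 <= c ^+ 2 * hfun b1 p * vfun b2 p < 1.

Lemma differential_frame_T k (q : M2) :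
  differential f2 (frame_T f2 e2 k q) = frame_A f2 e2 k q.
Proof.
rewrite /frame_T linear_sum.
by apply: eq_bigr => i _; rewrite linearZ.
Qed.

(** T_k is the frame expansion of grad f2 cut after k terms, so its coefficient on e_j is a_j or is
    missing. *)
Lemma metric_frame_T_e k (q : M2) j : U2 q ->
  g2 q (frame_T f2 e2 k q) (e2 j q) =
  if (j < k)%N then frame_a f2 e2 j q else 0.
Proof.
move=> Uq; rewrite /frame_T metric_tensor_suml.
have eE i : g2 q (frame_a f2 e2 i q *: e2 i q) (e2 j q) =
    if i == j then frame_a f2 e2 i q else 0.
  rewrite metric_tensorZl (metric_tensor_frame e2_frame) //.
  by case: ifP; rewrite ?mulr1 ?mulr0.
under eq_bigr do rewrite eE.
rewrite -big_mkcondr; case: ifP => jk.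
  rewrite (big_pred1 j) // => i /=.
  by case: eqP => [->|_]; rewrite ?jk ?andbF.
by rewrite big_pred0 // => i; case: eqP => [->|_]; rewrite ?jk ?andbF.
Qed.

Lemma metric_frame_T j k (q : M2) : U2 q -> (j <= k)%N ->
  g2 q (frame_T f2 e2 j q) (frame_T f2 e2 k q) = frame_A f2 e2 j q.
Proof.
move=> Uq jk; rewrite {1}/frame_T metric_tensor_suml; apply: eq_bigr => i ij.
rewrite metric_tensorZl metric_tensor_sym metric_frame_T_e //.
by rewrite (leq_trans ij jk).
Qed.

Lemma frame_AS (j : 'I_m2) (q : M2) :
  frame_A f2 e2 j.+1 q = frame_A f2 e2 j q + frame_a f2 e2 j q ^+ 2.
Proof.
rewrite /frame_A (bigD1 j) //= addrC; congr (_ + _).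
by apply: eq_bigl => i; rewrite ltnS [RHS]ltn_neqAle andbC.
Qed.

Let D k (p : M) : R := 1 - c ^+ 2 * hfun b1 p * vfun (frame_A f2 e2 k) p.

Lemma frame_denominator_gt0 k (p : M) : U2 p.2 -> 0 < D k p.
Proof.
move=> Up; rewrite subr_gt0; have /andP[_] := cb_lt1 p; apply: le_lt_trans.
apply: ler_wpM2l; first by rewrite mulr_ge0 ?sqr_ge0 ?grad_sqnorm_ge0.
rewrite /vfun /= (grad_sqnorm_frame e2_frame) // /frame_A.
(* b2 splits into A_k and the remaining squares, whose sum is nonnegative. *)
rewrite [leRHS](bigID (fun i : 'I_m2 => (i < k)%N)) /= lerDl.
by apply: sumr_ge0 => i _; exact: sqr_ge0.
Qed.

(** * Inner products of the vectors u'_j *)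

Local Notation u'_h := (frame_u'_h f2 e1).
Local Notation u'_v := (frame_u'_v g1 f1 f2 c e2).

Let K (j : 'I_m2) (p : M) : R := c * frame_a f2 e2 j p.2 / D j p.

Lemma frame_u'_hE i (p : M) :
  u'_h i p = row_mx ((f2 p.2)^-1 *: e1 i p.1 : 'rV_m1) (0 : 'rV_m2).
Proof. by rewrite /frame_u'_h hliftE scale_row_mx scaler0. Qed.

(** The factor 1/f1 common to the vertical block is pulled out, to cancel against f1^2 in the
    metric. *)
Lemma frame_u'_vE j (p : M) :
  u'_v j p = row_mx (- (K j p / f2 p.2) *: grad g1 f1 p.1 : 'rV_m1)
    ((f1 p.1)^-1 *: (K j p * c * b1 p.1 *: frame_T f2 e2 j p.2 + e2 j p.2) : 'rV_m2).
Proof.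
rewrite /frame_u'_v hliftE !vliftE !scale_row_mx !scaler0 add_row_mx.
rewrite scale_row_mx add_row_mx addr0 add0r addr0 scalerDr !scalerA.
by congr (row_mx (_ *: _) (_ *: _ + _)); rewrite /K /D /hfun /vfun /=; ring.
Qed.

Lemma warped_metric_hh i j (p : M) : U1 p.1 -> G (u'_h i p) (u'_h j p) = (i == j)%:R.
Proof.
move=> Up; rewrite !frame_u'_hE warped_metricE metric_tensorZl linearZ /=.
rewrite (metric_tensor_frame e1_frame) // !linear0 /=.
by field; exact: lt0r_neq0.
Qed.

(* If [u'_v k = (x, y)], the left-hand side is [f2 * df1 v] times
   [- K k + c * f1 * df2 y = c * a_k - K k * D k], which vanishes by the choice
   of [K k]. *)
Lemma warped_metric_hv (p : M) (v : tangent p.1) k : U2 p.2 ->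
  G (row_mx v 0 : tangent p) (u'_v k p) = 0.
Proof.
move=> Up; have D0 := lt0r_neq0 (frame_denominator_gt0 k Up).
have f10 := lt0r_neq0 (f1_gt0 p.1); have f20 := lt0r_neq0 (f2_gt0 p.2).
rewrite frame_u'_vE warped_metricE !linearZ !linearD !linearZ !linear0 /=.
rewrite (metric_tensor_sym _ v) gradP !metric_tensor0l.
rewrite differential_frame_T -[differential f2 _]/(frame_a f2 e2 k p.2).
have : K k p * D k p = c * frame_a f2 e2 k p.2 by rewrite /K mulfVK.
(* K_k and a_k become variables tied by [kE] alone, so that [field] meets no denominator other than
   f1 and f2. *)
rewrite /D /hfun /vfun /=; move: (K k p) (frame_a _ _ _ _) => k0 a kE.
rewrite -[k0 *: _]/(k0 * _) [LHS](_ : _ = differential f1 v * f2 p.2 *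
  (c * a - k0 * (1 - c ^+ 2 * b1 p.1 * frame_A f2 e2 k p.2))).
  by rewrite kE subrr mulr0.
by field; rewrite f10 f20.
Qed.

(* By [warped_metric_hv] the horizontal part of [u'_v j] does not contribute. *)
Lemma warped_metric_vv (j k : 'I_m2) (p : M) : U2 p.2 -> (j <= k)%N ->
  G (u'_v j p) (u'_v k p) = if j == k then D j.+1 p / D j p else 0.
Proof.
move=> Up jk; have D0 := lt0r_neq0 (frame_denominator_gt0 j Up).
have f10 := lt0r_neq0 (f1_gt0 p.1); have f20 := lt0r_neq0 (f2_gt0 p.2).
rewrite {1}frame_u'_vE.
set x : 'rV_m1 := _ *: grad g1 f1 p.1; set y : 'rV_m2 := _ *: (_ + _).
(* The factor 1 gives the sum the shape expected by [warped_metric_linear], which acts in the second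
   argument; hence the symmetry rewrites around it. *)
have -> : (row_mx x y : tangent p) = 1 *: (row_mx x 0 : tangent p) + row_mx 0 y.
  by rewrite scale1r [RHS]add_row_mx addr0 add0r.
rewrite warped_metric_sym warped_metric_linear warped_metric_sym.
rewrite warped_metric_hv // mulr0 add0r warped_metric_sym.
rewrite frame_u'_vE warped_metricE {}/x {}/y metric_tensor0l linear0.
rewrite metric_tensorZl metric_tensorDl metric_tensorZl.
rewrite !linearZ !linearD !linearZ /=.
rewrite (metric_frame_T Up jk) !differential_frame_T metric_frame_T_e //.
rewrite (metric_tensor_sym g2 (e2 j p.2)) metric_frame_T_e //.
rewrite (metric_tensor_frame e2_frame) //.
rewrite -(gradP g1 f1 (grad g1 f1 p.1)) -/(b1 p.1).
rewrite -[differential f2 (e2 j _)]/(frame_a f2 e2 j p.2).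
(* As j <= k, e_k does not occur in T_j; e_j occurs in T_k exactly when j < k. *)
rewrite ltnNge jk /= -[K k p *: _]/(K k p * _).
have [<-|jk'] := eqVneq j k; last first.
  by rewrite ltn_neqAle jk' jk /= mulr0n; field; rewrite f10 f20.
have KE : K j p = c * frame_a f2 e2 j p.2 / D j p by [].
(* On the diagonal the terms in A_j cancel, leaving 1 - c K_j b1 a_j; this recurrence identifies it
   with D_(j+1) / D_j. *)
have DE : D j.+1 p = D j p - c ^+ 2 * b1 p.1 * frame_a f2 e2 j p.2 ^+ 2.
  by rewrite /D /vfun /= frame_AS /hfun /=; ring.
by rewrite ltnn DE KE mulr1n; field; rewrite D0 f10 f20.
Qed.

(** * Normalization and orthonormality *)

Local Notation u' := (frame_u' g1 f1 f2 c e1 e2).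
Local Notation u := (frame_u g1 g2 f1 f2 c e1 e2).

Lemma frame_u'_lshift i : u' (lshift m2 i) = u'_h i.
Proof. by rewrite /frame_u' (unsplitK (inl i)). Qed.

Lemma frame_u'_rshift j : u' (rshift m1 j) = u'_v j.
Proof. by rewrite /frame_u' (unsplitK (inr j)). Qed.

Lemma frame_u_lshift i : u (lshift m2 i) = u'_h i.
Proof. by rewrite /frame_u (unsplitK (inl i)) frame_u'_lshift. Qed.

Lemma frame_u_rshift j :
  u (rshift m1 j) = fun p =>
    (tensor_norm (warped_metric g1 g2 f1 f2 c) (u'_v j p))^-1 *: u'_v j p.
Proof. by rewrite /frame_u (unsplitK (inr j)) frame_u'_rshift. Qed.

Lemma tensor_norm_frame_u' (j : 'I_m2) (p : M) : U2 p.2 ->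
  tensor_norm (warped_metric g1 g2 f1 f2 c) (u'_v j p) =
  Num.sqrt (D j.+1 p / D j p).
Proof. by move=> Up; rewrite /tensor_norm warped_metric_vv // eqxx. Qed.

Lemma tensor_norm_frame_u'_sqr (j : 'I_m2) (p : M) : U2 p.2 ->
  tensor_norm (warped_metric g1 g2 f1 f2 c) (u' (rshift m1 j) p) ^+ 2 =
  D j.+1 p / D j p.
Proof.
move=> Up; rewrite frame_u'_rshift tensor_norm_frame_u' // sqr_sqrtr //.
by apply/ltW/divr_gt0; exact: frame_denominator_gt0.
Qed.

Lemma frame_u_orthonormal (p : M) i j : U1 p.1 -> U2 p.2 ->
  G (u i p) (u j p) = (i == j)%:R.
Proof.
move=> U1p U2p.
have Zl a v w : G (a *: v : tangent p) w = a * G v w.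
  (* Homogeneity comes from [warped_metric_linear] with second summand 0, so the value at 0 is
     needed first; the instance 1, 0, 0 gives it. *)
  have L0 : G w (0 : tangent p) = 0.
    have := warped_metric_linear w 1 0 0; rewrite scale1r addr0 mul1r => /esym/eqP.
    by rewrite -subr_eq0 addrK => /eqP.
  by rewrite ![G _ w]warped_metric_sym -[a *: v]addr0 warped_metric_linear L0 addr0.
have Zr a v w : G v (a *: w : tangent p) = a * G v w.
  by rewrite warped_metric_sym Zl warped_metric_sym.
have hv k l : G (u'_h k p) (u'_v l p) = 0.
  by rewrite frame_u'_hE warped_metric_hv.
case: (split_ordP i) => k ->; case: (split_ordP j) => l ->.
- by rewrite !frame_u_lshift warped_metric_hh // (inj_eq (@lshift_inj _ _)).
- by rewrite frame_u_lshift frame_u_rshift Zr hv mulr0 eq_lrshift.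
- by rewrite frame_u_lshift frame_u_rshift Zl warped_metric_sym hv mulr0 eq_rlshift.
rewrite !frame_u_rshift Zl Zr (inj_eq (@rshift_inj _ _)).
have vv (k' l' : 'I_m2) : (k' <= l')%N -> k' != l' -> G (u'_v k' p) (u'_v l' p) = 0.
  by move=> kl /negbTE nkl; rewrite warped_metric_vv // nkl.
have [<-|kl] := eqVneq k l; last first.
  (* [warped_metric_vv] orders its indices; symmetry covers the other order. *)
  case/orP: (leq_total k l) => le_kl; first by rewrite vv // !mulr0.
  by rewrite warped_metric_sym vv 1?eq_sym // !mulr0.
rewrite tensor_norm_frame_u' // warped_metric_vv // eqxx.
have q0 : 0 < D k.+1 p / D k p by rewrite divr_gt0 ?frame_denominator_gt0.
have N0 : Num.sqrt (D k.+1 p / D k p) != 0 by rewrite gt_eqF ?sqrtr_gt0.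
(* The quotient is written as the square of its root, to cancel the two normalizing factors. *)
rewrite -[X in _ * (_ * X)](sqr_sqrtr (ltW q0)) expr2 mulKf //.
by rewrite mulVf.
Qed.

(** * Smoothness of the frame *)

Lemma smooth_frame_a j : smooth_fun_on U2 (frame_a f2 e2 j).
Proof. by have [oU [se _] _] := e2_frame; exact: smooth_derivation. Qed.

Lemma smooth_frame_A k : smooth_fun_on U2 (frame_A f2 e2 k).
Proof.
have [oU _ _] := e2_frame; apply: smooth_fun_on_sum => // i _.
by apply: smooth_fun_onM => //; exact: smooth_frame_a.
Qed.

Lemma smooth_frame_T k : smooth_vector_field U2 (frame_T f2 e2 k).
Proof.
have [oU [se _] _] := e2_frame; apply: smooth_vector_field_sum => // i _.
by apply: smooth_vector_fieldZ => //; exact: smooth_frame_a.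
Qed.

Let U : set M := U1 `*` U2.

Lemma open_frame_dom : open U.
Proof. by have [? _ _] := e1_frame; have [? _ _] := e2_frame; exact: open_setX. Qed.

Let smooth_hb1 : smooth_fun_on U (hfun b1).
Proof. exact: (smooth_hfun U2 (smooth_grad_sqnorm e1_frame f1_smooth)). Qed.

Lemma smooth_frame_denominator k : smooth_fun_on U (D k).
Proof.
have oU := open_frame_dom.
apply: (eq_smooth_fun_on oU (f := fun p => 1 +
    (- c ^+ 2) * (hfun b1 p * vfun (frame_A f2 e2 k) p))).
  by move=> p _; rewrite /D mulNr mulrA.
apply: smooth_fun_onD => //; first exact: smooth_fun_on_cst.
apply: smooth_fun_onM => //; first exact: smooth_fun_on_cst.
by apply: smooth_fun_onM => //; exact: (smooth_vfun U1 (smooth_frame_A k)).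
Qed.

Lemma frame_denominator_neq0 k (p : M) : U p -> D k p != 0.
Proof. by case=> _ Up; exact/lt0r_neq0/frame_denominator_gt0. Qed.

Let smooth_f1V : smooth_fun_on U (fun p => (hfun f1 p)^-1).
Proof.
apply: smooth_fun_onV; first exact: open_frame_dom.
  by move=> p _; exact/lt0r_neq0/f1_gt0.
exact: (smooth_hfun U2 (smooth_function_on U1 f1_smooth)).
Qed.

Let smooth_f2V : smooth_fun_on U (fun p => (vfun f2 p)^-1).
Proof.
apply: smooth_fun_onV; first exact: open_frame_dom.
  by move=> p _; exact/lt0r_neq0/f2_gt0.
exact: (smooth_vfun U1 (smooth_function_on U2 f2_smooth)).
Qed.

Lemma smooth_frame_u'_h i : smooth_vector_field U (u'_h i).
Proof.
have oU := open_frame_dom.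
have [oU1 [se _] _] := e1_frame; have [oU2 _ _] := e2_frame.
by apply: smooth_vector_fieldZ => //; exact: smooth_hlift.
Qed.

Lemma smooth_frame_u'_v j : smooth_vector_field U (u'_v j).
Proof.
have oU := open_frame_dom.
have [oU1 _ _] := e1_frame; have [oU2 [se _] _] := e2_frame.
apply: smooth_vector_fieldD => //; last first.
  by apply: smooth_vector_fieldZ => //; exact: smooth_vlift.
apply: smooth_vector_fieldZ => //.
  apply: smooth_fun_onM => //.
    apply: smooth_fun_onM => //; first exact: smooth_fun_on_cst.
    exact: (smooth_vfun U1 (smooth_frame_a j)).
  apply: smooth_fun_onV => //; last exact: smooth_frame_denominator.
  exact: frame_denominator_neq0.
apply: smooth_vector_fieldD => //; apply: smooth_vector_fieldZ => //.
- apply: (eq_smooth_fun_on oU (f := fun p => -1 * (vfun f2 p)^-1)).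
    by move=> p _; rewrite mulN1r.
  by apply: smooth_fun_onM => //; exact: smooth_fun_on_cst.
- by apply: smooth_hlift => //; exact: (smooth_grad e1_frame f1_smooth).
- apply: smooth_fun_onM => //; apply: smooth_fun_onM => //.
  exact: smooth_fun_on_cst.
- by apply: smooth_vlift => //; exact: smooth_frame_T.
Qed.

Lemma smooth_frame_u i : smooth_vector_field U (u i).
Proof.
have oU := open_frame_dom.
case: (split_ordP i) => j ->.
  by rewrite frame_u_lshift; exact: smooth_frame_u'_h.
rewrite frame_u_rshift; apply: smooth_vector_fieldZ => //; last first.
  exact: smooth_frame_u'_v.
have Dpos p : U p -> 0 < D j.+1 p / D j p.
  by case=> _ Up; rewrite divr_gt0 ?frame_denominator_gt0.
(* Over [U] the norm is replaced by its closed form, the root of a positive smooth quotient, instead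
   of being studied through the metric. *)
apply: (eq_smooth_fun_on oU (f := fun p => (Num.sqrt (D j.+1 p / D j p))^-1)).
  by move=> p [_ Up]; rewrite tensor_norm_frame_u'.
apply: smooth_fun_onV => //.
  by move=> p /Dpos Dp; rewrite gt_eqF // sqrtr_gt0.
apply: smooth_fun_on_sqrt => //; apply: smooth_fun_onM => //.
  exact: smooth_frame_denominator.
apply: smooth_fun_onV => //; last exact: smooth_frame_denominator.
exact: frame_denominator_neq0.
Qed.

End WarpedFrame.

(** * The norm formula and the orthonormal frame on the product *)

Theorem lemma3p5 (R : realType) (m1 m2 : nat)
    (M1 : manifold R m1) (M2 : manifold R m2)
    (g1 : riemannian_metric M1) (g2 : riemannian_metric M2)
    (f1 : M1 -> R) (f2 : M2 -> R) (c : R)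
    (f1_smooth : smooth_function f1) (f2_smooth : smooth_function f2)
    (f1_gt0 : forall p, 0 < f1 p) (f2_gt0 : forall q, 0 < f2 q)
    (cb_lt1 : forall p : prod_manifold M1 M2,
       0 <= c ^+ 2 * hfun (grad_sqnorm g1 f1) p * vfun (grad_sqnorm g2 f2) p < 1)
    (U1 : set M1) (U2 : set M2)
    (e1 : 'I_m1 -> vector_field M1) (e2 : 'I_m2 -> vector_field M2)
    (e1_frame : local_orthonormal_frame g1 U1 e1)
    (e2_frame : local_orthonormal_frame g2 U2 e2) :
  (forall (j : 'I_m2) (p : prod_manifold M1 M2), (U1 `*` U2) p ->
     tensor_norm (warped_metric g1 g2 f1 f2 c)
       (frame_u' g1 f1 f2 c e1 e2 (rshift m1 j) p) ^+ 2 =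
     (1 - c ^+ 2 * hfun (grad_sqnorm g1 f1) p * vfun (frame_A f2 e2 j.+1) p) /
     (1 - c ^+ 2 * hfun (grad_sqnorm g1 f1) p * vfun (frame_A f2 e2 j) p)) /\
  local_orthonormal_frame (warped_metric g1 g2 f1 f2 c) (U1 `*` U2)
    (frame_u g1 g2 f1 f2 c e1 e2).
Proof.
split=> [j p [_ Up]|]; first exact: tensor_norm_frame_u'_sqr Up.
split; first exact: (open_frame_dom e1_frame e2_frame).
  split=> [i|p [U1p U2p]]; first exact: smooth_frame_u.
  (* Orthonormality serves twice: here it makes the family a basis, and it is then the last clause
     itself. *)
  apply: (orthonormal_basis (G := @warped_metric _ _ _ _ _ g1 g2 f1 f2 c p)).
    exact: warped_metric_linear.
  by move=> i j; exact: (frame_u_orthonormal f1_smooth f2_smooth e1_frame e2_frame).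
move=> p [U1p U2p] i j.
exact: (frame_u_orthonormal f1_smooth f2_smooth e1_frame e2_frame).
Qed.
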